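(* Let $\mathbb{F}$ be an algebraically closed field and let $A$ be a unital locally matrix algebra over $\mathbb{F}$ of countable (i.e. countably infinite) dimension. For any two Cartan subalgebras $H'$, $H''$ of $A$ there exists an $\mathbb{F}$-algebra automorphism $\varphi$ of $A$ such that $\varphi(H')=H''$.
   Context: An associative $\mathbb{F}$-algebra $A$ with unit $1$ is a unital locally matrix algebra if for every finite collection $a_1,\ldots,a_s\in A$ there is a subalgebra $A'\subset A$ with $1,a_1,\ldots,a_s\in A'$ and $A'\cong M_n(\mathbb{F})$ for some $n\ge1$. A subalgebra $H$ of the matrix algebra $M_n(\mathbb{F})$ is a Cartan subalgebra if $H\cong\mathbb{F}\oplus\cdots\oplus\mathbb{F}$ ($n$ summands), i.e. $H$ is spanned by $n$ pairwise orthogonal nonzero idempotents. For a countable dimensional unital locally matrix algebra $A$, a decomposition $A=\bigotimes_{i=1}^\infty A_i$ into finite dimensional matrix algebras means: the $A_i$ are pairwise commuting subalgebras of $A$ containing $1$, each $A_i\cong M_{n_i}(\mathbb{F})$ for some $n_i\geq 1$, the multiplication maps $A_1\otimes_{\mathbb{F}}\cdots\otimes_{\mathbb{F}} A_k\to A$ are injective for all $k$, and $A$ is the union of their images. A subalgebra $H\subset A$ is called a Cartan subalgebra of $A$ if there exist such a decomposition $A=\bigotimes_{i=1}^\infty A_i$ and Cartan subalgebras $H_i$ of $A_i$ such that $H=\bigotimes_{i=1}^\infty H_i$, i.e. $H$ is the subalgebra of $A$ generated by all $H_i$. *)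

(* Defs.v *)
From mathcomp Require Import all_boot all_order all_algebra.
From mathcomp Require Import boolp classical_sets.
From mathcomp Require Import freeg.

Set Implicit Arguments.
Unset Strict Implicit.
Unset Printing Implicit Defensive.

Import GRing.Theory.
Local Open Scope classical_set_scope.
Local Open Scope ring_scope.

(* Subalgebras of A are sets S : set A. Matrix sizes are written m.+1, so that
   they are at least 1 and 'M[F]_m.+1 carries the library's algebra structure. *)

(* [{lrmorphism _ -> _}] maps 1 to 1: every matrix subalgebra contains 1. *)
Definition matrix_subalg (F : fieldType) (A : algType F) (m : nat)
    (S : set A) : Prop :=
  exists f : {lrmorphism 'M[F]_m.+1 -> A}, injective f /\ range f = S.

Definition locally_matrix (F : fieldType) (A : algType F) : Prop :=
  forall s : seq A, exists (m : nat) (S : set A),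
    [/\ matrix_subalg m S, S 1 & forall a, a \in s -> S a].

Definition countably_infinite_dim (F : fieldType) (V : lmodType F) : Prop :=
  exists b : nat -> V,
    (forall n (c : 'I_n -> F),
       \sum_(i < n) c i *: b i = 0 -> forall i, c i = 0) /\
    (forall v : V, exists n (c : 'I_n -> F), v = \sum_(i < n) c i *: b i).

Definition cartan_mx (F : fieldType) (m : nat) (H : set 'M[F]_m.+1) : Prop :=
  exists e : 'I_m.+1 -> 'M[F]_m.+1,
    [/\ forall i, e i != 0,
        forall i j, e i * e j = if i == j then e i else 0 &
        H = [set x | exists c : 'I_m.+1 -> F, x = \sum_i c i *: e i]].

Definition cartan_of_matrix_subalg (F : fieldType) (A : algType F) (m : nat)
    (S H : set A) : Prop :=
  exists f : {lrmorphism 'M[F]_m.+1 -> A},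
    [/\ injective f, range f = S &
        exists2 K, cartan_mx K & H = f @` K].

Definition lin_span (F : fieldType) (V : lmodType F) (G : set V) : set V :=
  smallest (fun S : set V => GRing.submod_closed (mem S)) G.

Definition alg_span (F : fieldType) (A : algType F) (G : set A) : set A :=
  smallest (fun S : set A => GRing.subalg_closed (mem S)) G.

(* The tensor product B_0 (x) ... (x) B_(k-1) of subspaces of A is the quotient
   of the free vector space [tensor_free B] on the tuples of B_0 x ... x B_(k-1)
   by its subspace [tensor_null B] spanned by the multilinearity relations; the
   multiplication map is induced by [tensor_mul] on the quotient. *)
Section Tensor.
Context (F : fieldType) (A : algType F) (k : nat).
Implicit Types (B : 'I_k -> set A) (a : {ffun 'I_k -> A}).

Definition tuple_upd a (i : 'I_k) (x : A) : {ffun 'I_k -> A} :=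
  [ffun j => if j == i then x else a j].

Definition tensor_free B : set {freeg {ffun 'I_k -> A} / F} :=
  lin_span [set << a >> | a in [set a : {ffun 'I_k -> A} | forall i, B i (a i)]].

Definition tensor_null B : set {freeg {ffun 'I_k -> A} / F} :=
  lin_span [set r | exists a i (c : F) x y,
    [/\ forall j, B j (a j), B i x, B i y &
        r = << tuple_upd a i (c *: x + y) >>
            - (c *: << tuple_upd a i x >> + << tuple_upd a i y >>)]].

Definition tensor_mul (t : {freeg {ffun 'I_k -> A} / F}) : A :=
  fglift (fun a => \prod_(i < k) a i) t.

Definition tensor_mul_injective B : Prop :=
  forall t, tensor_free B t -> tensor_mul t = 0 -> tensor_null B t.

Definition tensor_mul_image B : set A := tensor_mul @` tensor_free B.

End Tensor.

Definition tensor_decomposition (F : fieldType) (A : algType F)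
    (m_ : nat -> nat) (A_ : nat -> set A) : Prop :=
  [/\ forall i, matrix_subalg (m_ i) (A_ i),
      forall i j x y, i != j -> A_ i x -> A_ j y -> x * y = y * x,
      forall k, tensor_mul_injective (fun i : 'I_k => A_ i) &
      \bigcup_k tensor_mul_image (fun i : 'I_k => A_ i) = [set: A]].

Definition cartan_subalg (F : fieldType) (A : algType F) (H : set A) : Prop :=
  exists (m_ : nat -> nat) (A_ H_ : nat -> set A),
    [/\ tensor_decomposition m_ A_,
        forall i, cartan_of_matrix_subalg (m_ i) (A_ i) (H_ i) &
        H = alg_span (\bigcup_i H_ i)].

(* Main.v *)
From HB Require Import structures.
Require Import Defs.
From mathcomp Require Import all_boot all_order all_algebra.
From mathcomp Require Import boolp classical_sets.
From mathcomp Require Import freeg.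

Set Implicit Arguments.
Unset Strict Implicit.
Unset Printing Implicit Defensive.

Import GRing.Theory.
Local Open Scope classical_set_scope.
Local Open Scope ring_scope.

(** A Cartan subalgebra H of A, with its decomposition, gives matrix units of size
    N_k = n_0 ... n_(k-1) in A_0 ... A_(k-1) whose diagonal spans the k-th partial
    product of the H_i.  If they are indexed by mixed-radix integers with the
    least significant digit first, then a unit of level k is
    e_k(i, j) = sum_t e_(k+1)(i + N_k t, j + N_k t), a rule that only involves
    the sizes.  Applied to any size n dividing some N_k, it produces units of size
    n that do not depend on k.  By a rank argument, every size of one of the two
    towers divides some size of the other, so both towers can be rewritten with
    the same sizes.  The pairs of corresponding units are then a tower of matrix
    units in A * A, and the union of their spans is the graph of the required
    automorphism. *)

(** * Subspaces and subalgebras as closed sets *)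

Lemma submod_closedP (F : fieldType) (V : lmodType F) (S : set V) :
  GRing.submod_closed (mem S) <->
  S 0 /\ forall c u v, S u -> S v -> S (c *: u + v).
Proof.
split=> [[S0 SD]|[S0 SD]].
  split=> [|c u v Su Sv]; first exact: set_mem.
  by apply: set_mem; apply: SD; apply: mem_set.
split=> [|c u v /set_mem Su /set_mem Sv]; first exact: mem_set.
by apply: mem_set; apply: SD.
Qed.

Lemma subalg_closedP (F : fieldType) (B : algType F) (S : set B) :
  GRing.subalg_closed (mem S) <->
  [/\ S 1, forall c u v, S u -> S v -> S (c *: u + v)
    & forall u v, S u -> S v -> S (u * v)].
Proof.
split=> [[S1 SD SM]|[S1 SD SM]].
  split=> [|c u v Su Sv|u v Su Sv]; first exact: set_mem.
    by apply: set_mem; apply: SD; apply: mem_set.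
  by apply: set_mem; apply: SM; apply: mem_set.
split=> [|c u v /set_mem Su /set_mem Sv|u v /set_mem Su /set_mem Sv].
- exact: mem_set.
- by apply: mem_set; apply: SD.
- by apply: mem_set; apply: SM.
Qed.

Lemma subalg_submod (F : fieldType) (B : algType F) (S : set B) :
  GRing.subalg_closed (mem S) -> GRing.submod_closed (mem S).
Proof.
move=> /subalg_closedP[S1 SD SM]; apply/submod_closedP; split=> //.
by have := SD (- 1) _ _ S1 S1; rewrite scaleN1r addNr.
Qed.

Lemma submod_sumZ (F : fieldType) (V : lmodType F) (S : set V) n
    (c : 'I_n -> F) (x : 'I_n -> V) :
  GRing.submod_closed (mem S) -> (forall i, S (x i)) ->
  S (\sum_i c i *: x i).
Proof.
move=> /submod_closedP[S0 SD] Sx; apply: (big_ind S) => // [u v Su Sv|i _].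
  by have := SD 1 _ _ Su Sv; rewrite scale1r.
by have := SD (c i) _ _ (Sx i) S0; rewrite addr0.
Qed.

Lemma submod_sum (F : fieldType) (V : lmodType F) (S : set V) n
    (x : 'I_n -> V) :
  GRing.submod_closed (mem S) -> (forall i, S (x i)) -> S (\sum_i x i).
Proof.
move=> Scl Sx; rewrite (eq_bigr (fun i => 1 *: x i)) => [|i _].
  exact: submod_sumZ.
by rewrite scale1r.
Qed.

(** Each u < N * r is uniquely i + N t with i < N and t < r, where i is the least significant
    digit. *)
Lemma sum_mulnE (V : nmodType) (N r : nat) (f : nat -> V) :
  \sum_(u < N * r) f u = \sum_(t < r) \sum_(i < N) f (i + N * t)%N.
Proof.
elim: r => [|r IHr]; first by rewrite muln0 !big_ord0.
rewrite big_ord_recr /= -IHr mulnS addnC big_split_ord /=.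
by congr (_ + _); apply: eq_bigr => i _; rewrite addnC.
Qed.

(** * Systems of matrix units and their spans *)

Section MatrixUnits.
Context (F : fieldType) (B : algType F).
Implicit Types (N r s : nat) (e : nat -> nat -> B).

(** Units are indexed by [nat] rather than ['I_N], so that sizes can be rewritten without casts;
    only the values at indices below N are constrained. *)
Definition mxunits N e : Prop :=
  (forall i j k l : 'I_N, e i j * e k l = e i l *+ (j == k)) /\
  \sum_(i < N) e i i = 1.

Definition mx_eval N e (X : 'M[F]_N) : B := \sum_i \sum_j X i j *: e i j.

Definition mxspan N e : set B := range (@mx_eval N e).

Definition diagspan N e : set B :=
  [set mx_eval e (diag_mx d) | d in [set: 'rV[F]_N]].

Lemma mx_eval_is_linear N e : linear (@mx_eval N e).
Proof.
move=> c X Y; rewrite /mx_eval scaler_sumr -big_split; apply: eq_bigr => i _.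
rewrite scaler_sumr -big_split; apply: eq_bigr => j _.
by rewrite !mxE scalerDl scalerA.
Qed.

HB.instance Definition _ N e := GRing.isLinear.Build F 'M[F]_N B *:%R
  (@mx_eval N e) (@mx_eval_is_linear N e).

Lemma mx_eval_diag N e d : @mx_eval N e (diag_mx d) = \sum_i d 0 i *: e i i.
Proof.
apply: eq_bigr => i _; rewrite (bigD1 i) //= big1 ?addr0 => [|j ji].
  by rewrite mxE eqxx mulr1n.
by rewrite mxE eq_sym (negPf ji) mulr0n scale0r.
Qed.

Lemma mx_evalM N e (X Y : 'M[F]_N) : mxunits N e ->
  mx_eval e X * mx_eval e Y = mx_eval e (X *m Y).
Proof.
case=> eM _; rewrite /mx_eval mulr_suml; apply: eq_bigr => i _.
rewrite mulr_suml.
transitivity (\sum_j \sum_l (X i j * Y j l) *: e i l).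
  apply: eq_bigr => j _; rewrite mulr_sumr (bigD1 j) //= addrC big1 ?add0r.
    rewrite mulr_sumr; apply: eq_bigr => l _.
    by rewrite -scalerAl -scalerAr scalerA eM eqxx.
  move=> k kj; rewrite mulr_sumr big1 // => l _.
  by rewrite -scalerAl -scalerAr eM eq_sym (negPf kj) !scaler0.
by rewrite exchange_big; apply: eq_bigr => l _; rewrite mxE scaler_suml.
Qed.

Lemma mx_eval1 N e : mxunits N e -> mx_eval e (1%:M : 'M[F]_N) = 1.
Proof.
move=> [_ <-]; rewrite -diag_const_mx mx_eval_diag; apply: eq_bigr => i _.
by rewrite mxE scale1r.
Qed.

Lemma mx_eval_delta N e (i j : 'I_N) : mx_eval e (delta_mx i j) = e i j.
Proof.
rewrite /mx_eval (bigD1 i) //= (bigD1 j) //= !big1 => [|k ki|k kj].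
- by rewrite mxE !eqxx scale1r !addr0.
- by rewrite big1 // => l _; rewrite mxE (negPf ki) scale0r.
- by rewrite mxE (negPf kj) andbF scale0r.
Qed.

(** Multiplying by e k i on the left and by e j k on the right isolates [X i j *: e k k]. A nonzero
    entry would thus kill every e k k, hence their sum 1. *)
Lemma mx_eval_eq0 N e (X : 'M[F]_N) : mxunits N e -> mx_eval e X = 0 -> X = 0.
Proof.
move=> [eM e1] X0; apply/matrixP => i j; rewrite mxE; apply/eqP.
apply: contraT => Xij.
suff ekk0 (k : 'I_N) : e k k = 0.
  by have := oner_neq0 B; rewrite -e1 big1 ?eqxx.
have row_i : e k i * mx_eval e X = \sum_l X i l *: e k l.
  rewrite mulr_sumr (bigD1 i) //= addrC big1 ?add0r.
    rewrite mulr_sumr; apply: eq_bigr => l _.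
    by rewrite -scalerAr eM eqxx.
  move=> a ai; rewrite mulr_sumr big1 // => l _.
  by rewrite -scalerAr eM eq_sym (negPf ai) scaler0.
have : (\sum_l X i l *: e k l) * e j k = X i j *: e k k.
  rewrite mulr_suml (bigD1 j) //= big1 => [|l lj].
    by rewrite addr0 -scalerAl eM eqxx.
  by rewrite -scalerAl eM (negPf lj) scaler0.
rewrite -row_i X0 mulr0 mul0r => /esym/eqP.
by rewrite scaler_eq0 (negPf Xij) => /eqP.
Qed.

Lemma mx_eval_inj N e : mxunits N e -> injective (@mx_eval N e).
Proof.
move=> eN X Y XY; apply/eqP; rewrite -subr_eq0; apply/eqP.
apply: (mx_eval_eq0 eN).
by rewrite linearB /= XY subrr.
Qed.

Lemma mxspan_submod N e : GRing.submod_closed (mem (mxspan N e)).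
Proof.
apply/submod_closedP; split.
  by exists 0 => //; rewrite linear0.
move=> c _ _ [X _ <-] [Y _ <-]; exists (c *: X + Y) => //.
by rewrite linearP.
Qed.

Lemma mxspan_subalg N e : mxunits N e -> GRing.subalg_closed (mem (mxspan N e)).
Proof.
move=> eN; have /submod_closedP[_ SD] := mxspan_submod N e.
apply/subalg_closedP; split=> //.
  by exists 1%:M => //; apply: mx_eval1.
by move=> _ _ [X _ <-] [Y _ <-]; exists (X *m Y) => //; rewrite mx_evalM.
Qed.

Lemma mem_mxspan N e i j : (i < N)%N -> (j < N)%N -> mxspan N e (e i j).
Proof.
move=> iN jN; exists (delta_mx (Ordinal iN) (Ordinal jN)) => //.
exact: mx_eval_delta.
Qed.

Lemma mxspan_sub N e (S : set B) : GRing.submod_closed (mem S) ->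
  (forall i j, (i < N)%N -> (j < N)%N -> S (e i j)) -> mxspan N e `<=` S.
Proof.
move=> Scl Se _ [X _ <-]; apply: submod_sum => // i.
by apply: submod_sumZ => // j; apply: Se.
Qed.

Lemma diagspan_submod N e : GRing.submod_closed (mem (diagspan N e)).
Proof.
apply/submod_closedP; split.
  by exists 0 => //; rewrite !linear0.
move=> c _ _ [X _ <-] [Y _ <-]; exists (c *: X + Y) => //.
by rewrite !linearP.
Qed.

Lemma diagspan_subalg N e :
  mxunits N e -> GRing.subalg_closed (mem (diagspan N e)).
Proof.
move=> eN; have /submod_closedP[_ SD] := diagspan_submod N e.
apply/subalg_closedP; split=> //.
  by exists (const_mx 1) => //; rewrite diag_const_mx; apply: mx_eval1.
move=> _ _ [X _ <-] [Y _ <-]; exists (\row_j (X 0 j * Y 0 j)) => //.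
by rewrite mx_evalM // mulmx_diag.
Qed.

Lemma mem_diagspan N e i : (i < N)%N -> diagspan N e (e i i).
Proof.
move=> iN; exists (delta_mx 0 (Ordinal iN)) => //.
rewrite mx_eval_diag (bigD1 (Ordinal iN)) //= big1 => [|j ji].
  by rewrite mxE !eqxx scale1r addr0.
by rewrite mxE (negPf ji) andbF scale0r.
Qed.

Lemma diagspan_sub N e (S : set B) : GRing.submod_closed (mem S) ->
  (forall i, (i < N)%N -> S (e i i)) -> diagspan N e `<=` S.
Proof.
move=> Scl Se _ [X _ <-]; rewrite mx_eval_diag; apply: submod_sumZ => // i.
exact: Se.
Qed.

(** From units of size N r this makes the coarser system of size N given by the block-diagonal
    embedding X -> diag(X, ..., X) with r blocks: t numbers the block and i, j the position inside
    it. *)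
Definition refine N r e : nat -> nat -> B :=
  fun i j => \sum_(t < r) e (i + N * t)%N (j + N * t)%N.

Lemma refine1 N e i j : refine N 1 e i j = e i j.
Proof. by rewrite /refine big_ord1 muln0 !addn0. Qed.

(** Two block numbers t < r and u < s merge into the single number t + r u < r s. *)
Lemma refine_comp N r s e i j :
  refine N r (refine (N * r) s e) i j = refine N (r * s) e i j.
Proof.
rewrite /refine (sum_mulnE r s (fun u => e (i + N * u)%N (j + N * u)%N)).
rewrite exchange_big; apply: eq_bigr => t _; apply: eq_bigr => u _.
by rewrite !mulnDr !mulnA !addnA.
Qed.

Lemma ltn_digits N r i t : (i < N)%N -> (t < r)%N -> (i + N * t < N * r)%N.
Proof.
move=> iN tr; apply: (@leq_trans (N * t.+1)%N); first by rewrite mulnS ltn_add2r.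
by rewrite leq_mul2l tr orbT.
Qed.

Lemma eq_refine N r e e' i j :
  (forall a b, (a < N * r)%N -> (b < N * r)%N -> e a b = e' a b) ->
  (i < N)%N -> (j < N)%N -> refine N r e i j = refine N r e' i j.
Proof.
by move=> ee' iN jN; apply: eq_bigr => t _; apply: ee'; apply: ltn_digits.
Qed.

Lemma eqn_digits N i j t u : (i < N)%N -> (j < N)%N ->
  (i + N * t == j + N * u)%N = (i == j) && (t == u).
Proof.
move=> iN jN; apply/eqP/andP => [eq_ij|[/eqP-> /eqP->] //].
have N0 : (0 < N)%N by case: N iN {jN eq_ij}.
have := congr1 (modn^~ N) eq_ij; have := congr1 (divn^~ N) eq_ij.
rewrite /= ![(_ + N * _)%N]addnC ![(N * _)%N]mulnC !divnMDl // !modnMDl.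
by rewrite !divn_small // !modn_small // !addn0 => -> ->.
Qed.

(** Distinct blocks are orthogonal, and inside a block the relations are those of e. *)
Lemma refine_mxunits N r e : mxunits (N * r) e -> mxunits N (refine N r e).
Proof.
move=> [eM e1]; split=> [i j k l|]; last first.
  by rewrite /refine exchange_big -(sum_mulnE N r (fun u => e u u)).
have eM' a b c d : (a < N * r)%N -> (b < N * r)%N -> (c < N * r)%N ->
    (d < N * r)%N -> e a b * e c d = e a d *+ (b == c).
  move=> aN bN cN dN.
  exact: (eM (Ordinal aN) (Ordinal bN) (Ordinal cN) (Ordinal dN)).
rewrite /refine mulr_suml -sumrMnl; apply: eq_bigr => t _.
rewrite mulr_sumr (bigD1 t) //= big1 ?addr0 => [|u ut].
  by rewrite eM' ?ltn_digits // eqn_digits // eqxx andbT.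
have tu : (t == u :> nat) = false by rewrite eq_sym; apply/negbTE.
by rewrite eM' ?ltn_digits // eqn_digits // tu andbF.
Qed.

Lemma mxspan_refine N r e e' :
  (forall i j, (i < N)%N -> (j < N)%N -> e i j = refine N r e' i j) ->
  mxspan N e `<=` mxspan (N * r) e'.
Proof.
move=> ee'; apply: mxspan_sub => [|i j iN jN]; first exact: mxspan_submod.
rewrite ee' //; apply: submod_sum => [|t]; first exact: mxspan_submod.
by apply: mem_mxspan; apply: ltn_digits.
Qed.

Lemma diagspan_refine N r e e' :
  (forall i j, (i < N)%N -> (j < N)%N -> e i j = refine N r e' i j) ->
  diagspan N e `<=` diagspan (N * r) e'.
Proof.
move=> ee'; apply: diagspan_sub => [|i iN]; first exact: diagspan_submod.
rewrite ee' //; apply: submod_sum => [|t]; first exact: diagspan_submod.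
by apply: mem_diagspan; apply: ltn_digits.
Qed.

End MatrixUnits.

(** * Towers of matrix units and changes of their sizes *)

Section Tower.
Context (F : fieldType) (B : algType F).
Implicit Types (N : nat -> nat) (E : nat -> nat -> nat -> B).

(** An ascending chain of matrix algebras whose inclusions are the unital block-diagonal embeddings,
    so that they are determined by the sizes alone. *)
Definition tower N E : Prop :=
  (forall k, mxunits (N k) (E k)) /\
  forall k, exists2 r, N k.+1 = (N k * r)%N &
    forall i j, (i < N k)%N -> (j < N k)%N ->
      E k i j = refine (N k) r (E k.+1) i j.

Definition tower_alg N E : set B := \bigcup_k mxspan (N k) (E k).

Definition tower_diag N E : set B := \bigcup_k diagspan (N k) (E k).

Lemma mxunits_gt0 (n : nat) (e : nat -> nat -> B) : mxunits n e -> (0 < n)%N.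
Proof.
case: n => // -[_ /eqP]; rewrite big_ord0 eq_sym.
by rewrite (negPf (oner_neq0 B)).
Qed.

Lemma tower_le N E k l : tower N E -> (k <= l)%N ->
  exists2 r, N l = (N k * r)%N &
    forall i j, (i < N k)%N -> (j < N k)%N -> E k i j = refine (N k) r (E l) i j.
Proof.
case=> EU Estep /subnK <-; elim: (l - k)%N => [|d [r Nr Er]].
  by exists 1%N => [|i j iN jN]; rewrite ?add0n ?muln1 // refine1.
have [s Ns Es] := Estep (d + k)%N; rewrite addSn.
exists (r * s)%N => [|i j iN jN]; first by rewrite Ns Nr mulnA.
rewrite Er // -refine_comp; apply: eq_refine => // a b.
by rewrite -Nr => aN bN; apply: Es.
Qed.

Lemma tower_mxspan_le N E k l : tower N E -> (k <= l)%N ->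
  mxspan (N k) (E k) `<=` mxspan (N l) (E l).
Proof. by move=> TE /(tower_le TE)[r -> Er]; apply: mxspan_refine. Qed.

Lemma tower_diagspan_le N E k l : tower N E -> (k <= l)%N ->
  diagspan (N k) (E k) `<=` diagspan (N l) (E l).
Proof. by move=> TE /(tower_le TE)[r -> Er]; apply: diagspan_refine. Qed.

Lemma bigcup_subalg (S : nat -> set B) :
  (forall k, GRing.subalg_closed (mem (S k))) ->
  (forall k l, (k <= l)%N -> S k `<=` S l) ->
  GRing.subalg_closed (mem (\bigcup_k S k)).
Proof.
move=> Scl Sle; apply/subalg_closedP; split=> [|c u v|u v].
- by have /subalg_closedP[S1 _ _] := Scl 0; exists 0.
- move=> [k _ Su] [l _ Sv]; exists (maxn k l) => //.
  have /subalg_closedP[_ SD _] := Scl (maxn k l).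
  by apply: SD; [apply: Sle Su; apply: leq_maxl | apply: Sle Sv; apply: leq_maxr].
- move=> [k _ Su] [l _ Sv]; exists (maxn k l) => //.
  have /subalg_closedP[_ _ SM] := Scl (maxn k l).
  by apply: SM; [apply: Sle Su; apply: leq_maxl | apply: Sle Sv; apply: leq_maxr].
Qed.

Lemma tower_alg_subalg N E :
  tower N E -> GRing.subalg_closed (mem (tower_alg N E)).
Proof.
move=> TE; apply: bigcup_subalg => [k|k l kl]; last exact: tower_mxspan_le.
by apply: mxspan_subalg; case: TE.
Qed.

Lemma tower_diag_subalg N E :
  tower N E -> GRing.subalg_closed (mem (tower_diag N E)).
Proof.
move=> TE; apply: bigcup_subalg => [k|k l kl]; last exact: tower_diagspan_le.
by apply: diagspan_subalg; case: TE.
Qed.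

(** For k <= l the units of level k are coarsenings of those of level l, and [refine_comp] merges
    the two coarsenings. A size n dividing some level thus has its own units, which is what
    [retower] needs. *)
Lemma refine_level N E n k r l s i j : tower N E ->
  N k = (n * r)%N -> N l = (n * s)%N -> (i < n)%N -> (j < n)%N ->
  refine n r (E k) i j = refine n s (E l) i j.
Proof.
move=> TE.
wlog kl : k l r s / (k <= l)%N => [hw|] Nk Nl iN jN.
  by have [kl|lk] := leqP k l; [|apply/esym]; apply: hw => //; apply: ltnW.
have [t Nt Et] := tower_le TE kl.
have n0 : (0 < n)%N by case: n iN {jN Nk Nl}.
have st : s = (r * t)%N.
  by apply/eqP; rewrite -(eqn_pmul2l n0) -Nl Nt Nk mulnA.
rewrite st -refine_comp; apply: eq_refine => // a b.
by rewrite -Nk => aN bN; apply: Et.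
Qed.

(** The two sequences of sizes interleave for divisibility, so each system of either tower is a
    coarsening of a system of the other and the unions agree. *)
Lemma retower N E M : tower N E ->
  (forall k, M k %| M k.+1)%N ->
  (forall k, exists l, M k %| N l)%N -> (forall l, exists k, N l %| M k)%N ->
  exists2 G, tower M G &
    tower_alg M G = tower_alg N E /\ tower_diag M G = tower_diag N E.
Proof.
move=> TE Mdvd /choice[l Ml] NM.
pose r k := (N (l k) %/ M k)%N.
have Nr k : N (l k) = (M k * r k)%N by rewrite /r mulnC divnK.
pose G k := refine (M k) (r k) (E (l k)).
(* A coarsening of [G k] is one of level [l k] of E, so every comparison below reduces to
   [refine_level]. *)
have GE k n q i j : M k = (n * q)%N -> (i < n)%N -> (j < n)%N ->
    refine n q (G k) i j = refine n (q * r k) (E (l k)) i j.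
  by move=> Mq iN jN; rewrite -refine_comp /G -Mq.
have TG : tower M G.
  split=> k; first by apply: refine_mxunits; rewrite -Nr; case: TE.
  have Mq : M k.+1 = (M k * (M k.+1 %/ M k))%N by rewrite mulnC divnK.
  exists (M k.+1 %/ M k)%N => // i j iM jM.
  rewrite GE //; apply: (refine_level TE) => //.
  by rewrite Nr {1}Mq mulnA.
have EG k : exists2 h, M h = (N k * (M h %/ N k))%N &
    forall i j, (i < N k)%N -> (j < N k)%N ->
      E k i j = refine (N k) (M h %/ N k) (G h) i j.
  have [h kh] := NM k.
  have Mq : M h = (N k * (M h %/ N k))%N by rewrite mulnC divnK.
  (* [E k] is read as its own coarsening with a single block. *)
  exists h => // i j iN jN; rewrite GE // -[LHS](refine1 (N k)).
  by apply: (refine_level TE) => //; rewrite ?muln1 // Nr {1}Mq mulnA.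
exists G => //; split; apply/seteqP; split=> x [k _ Sx].
- by exists (l k) => //; rewrite Nr; apply: mxspan_refine Sx.
- have [h Mq Eq] := EG k; exists h => //; rewrite Mq.
  exact: mxspan_refine Sx.
- by exists (l k) => //; rewrite Nr; apply: diagspan_refine Sx.
- have [h Mq Eq] := EG k; exists h => //; rewrite Mq.
  exact: diagspan_refine Sx.
Qed.

End Tower.

(** * Automorphisms as subalgebras of A * A *)

(** Choice gives a function in each direction. Trivial fibres over 0 make U single-valued both ways,
    so the closure of U becomes linearity and multiplicativity of f, and the two functions are
    mutually inverse. *)
Lemma graph_automorphism (F : fieldType) (A : algType F) (U : set (A * A)) :
  GRing.subalg_closed (mem U) ->
  (forall a, exists b, U (a, b)) -> (forall b, exists a, U (a, b)) ->
  (forall b, U (0, b) -> b = 0) -> (forall a, U (a, 0) -> a = 0) ->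
  exists phi : {lrmorphism A -> A},
    bijective phi /\ forall a b, U (a, b) <-> phi a = b.
Proof.
move=> /subalg_closedP[U1 UD UM] /choice[f Uf] /choice[g Ug] U0r U0l.
have subU a b a' b' : U (a, b) -> U (a', b') -> U (a - a', b - b').
  by move=> Uab Uab'; have := UD (- 1) _ _ Uab' Uab; rewrite scaleN1r /= addrC.
have Ur a b b' : U (a, b) -> U (a, b') -> b = b'.
  move=> Uab Uab'; apply/eqP; rewrite -subr_eq0; apply/eqP/U0r.
  by rewrite -(subrr a); apply: subU.
have Ul a a' b : U (a, b) -> U (a', b) -> a = a'.
  move=> Uab Uab'; apply/eqP; rewrite -subr_eq0; apply/eqP/U0l.
  by rewrite -(subrr b); apply: subU.
have f_lin : linear f.
  by move=> c u v; apply: Ur (Uf _) _; apply: (UD c (u, f u) (v, f v)).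
have f_mul : monoid_morphism f.
  split=> [|u v]; first by apply: Ur (Uf _) _.
  by apply: Ur (Uf _) _; apply: (UM (u, f u) (v, f v)).
pose lM := GRing.isLinear.Build F A A *:%R f f_lin.
pose mM := GRing.isMonoidMorphism.Build A A f f_mul.
pose phi : {lrmorphism A -> A} := HB.pack f lM mM.
exists phi; split=> [|a b].
  exists g => [a|b]; first exact: Ul (Ug _) (Uf _).
  exact: Ur (Uf _) (Ug _).
by split=> [Uab|<-]; [apply: Ur (Uf a) Uab | apply: Uf].
Qed.

(** * Conjugacy of towers with equal sizes *)

Section Uniqueness.
Context (F : fieldType) (A : algType F).
Implicit Types (N : nat -> nat).

Lemma fst_mx_eval n (d e : nat -> nat -> A) (X : 'M[F]_n) :
  (mx_eval (fun i j => (d i j, e i j)) X).1 = mx_eval d X.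
Proof.
rewrite /mx_eval raddf_sum; apply: eq_bigr => i _.
by rewrite raddf_sum.
Qed.

Lemma snd_mx_eval n (d e : nat -> nat -> A) (X : 'M[F]_n) :
  (mx_eval (fun i j => (d i j, e i j)) X).2 = mx_eval e X.
Proof.
rewrite /mx_eval raddf_sum; apply: eq_bigr => i _.
by rewrite raddf_sum.
Qed.

Lemma pair_mx_eval n (d e : nat -> nat -> A) (X : 'M[F]_n) :
  mx_eval (fun i j => (d i j, e i j)) X = (mx_eval d X, mx_eval e X).
Proof. by rewrite [LHS]surjective_pairing fst_mx_eval snd_mx_eval. Qed.

Lemma pair_mxunits n (d e : nat -> nat -> A) :
  mxunits n d -> mxunits n e -> mxunits n (fun i j => (d i j, e i j)).
Proof.
move=> [dM d1] [eM e1]; split=> [i j k l|]; last first.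
  by rewrite [LHS]surjective_pairing !raddf_sum /= d1 e1.
rewrite [LHS]surjective_pairing [RHS]surjective_pairing !raddfMn /=.
by congr (_, _); [apply: dM | apply: eM].
Qed.

Lemma pair_refine n r (d e : nat -> nat -> A) i j :
  refine n r (fun i j => (d i j, e i j)) i j = (refine n r d i j, refine n r e i j).
Proof. by rewrite [LHS]surjective_pairing !raddf_sum. Qed.

(** The pairs of units form a tower in A * A, and its algebra is a graph sending [mx_eval (D k) X]
    to [mx_eval (E k) X]. Taking X diagonal gives the statement on diagonals. *)
Lemma tower_conjugate N (D E : nat -> nat -> nat -> A) :
  tower N D -> tower N E ->
  tower_alg N D = [set: A] -> tower_alg N E = [set: A] ->
  exists phi : {lrmorphism A -> A},
    bijective phi /\ phi @` tower_diag N D = tower_diag N E.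
Proof.
move=> [DU Ds] [EU Es] DT ET.
pose P k i j := (D k i j, E k i j).
have TP : tower N P.
  split=> k; first by apply: pair_mxunits.
  have [r Nr Dr] := Ds k; have [s Ns Er] := Es k.
  exists r => // i j iN jN; rewrite pair_refine -Dr //.
  (* Both ratios are N k.+1 / N k, because the towers share their sizes. *)
  suff <- : s = r by rewrite -Er.
  by apply/eqP; rewrite -(eqn_pmul2l (mxunits_gt0 (DU k))) -Ns Nr.
have inP k (X : 'M_(N k)) : tower_alg N P (mx_eval (D k) X, mx_eval (E k) X).
  by exists k => //; exists X => //; apply: pair_mx_eval.
have [||||phi [phi_bij phiP]] := graph_automorphism (tower_alg_subalg TP).
- move=> a; have: tower_alg N D a by rewrite DT.
  by move=> [k _ [X _ <-]]; exists (mx_eval (E k) X).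
- move=> b; have: tower_alg N E b by rewrite ET.
  by move=> [k _ [X _ <-]]; exists (mx_eval (D k) X).
(* By independence of the units [D k], a zero first component forces X = 0, hence a zero second
   component. *)
- move=> b [k _ [X _]]; rewrite pair_mx_eval => -[/(mx_eval_eq0 (DU k)) -> <-].
  by rewrite linear0.
- move=> b [k _ [X _]]; rewrite pair_mx_eval => -[<- /(mx_eval_eq0 (EU k)) ->].
  by rewrite linear0.
exists phi; split=> //; apply/seteqP.
split=> [_ [_ [k _ [d _ <-]] <-]|_ [k _ [d _ <-]]].
  have /phiP -> := inP k (diag_mx d).
  by exists k => //; exists d.
exists (mx_eval (D k) (diag_mx d)); first by exists k => //; exists d.
exact/phiP.
Qed.

End Uniqueness.

(** * Divisibility between sizes *)

(** The X i i are orthogonal idempotents of sum 1, so the row space of dimension m is the direct sum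
    of their images. These have equal rank since X i i = X i j X j j X j i, so m is n times this
    rank. *)
Lemma mx_mxunits_dvdn (F : fieldType) n m (X : 'I_n -> 'I_n -> 'M[F]_m) :
  (forall i j k l, X i j *m X k l = X i l *+ (j == k)) ->
  \sum_i X i i = 1%:M -> (n %| m)%N.
Proof.
move=> XM X1.
have direct : mxdirect (\sum_i X i i).
  apply/mxdirect_sumsP => i _; apply/eqP; rewrite -submx0; apply/rV_subP => v.
  rewrite sub_capmx => /andP[/submxP[w ->]] sub_ker; apply/submxP; exists 0.
  (* Right multiplication by X i i fixes the row space of X i i and kills that of X j j for j !=
     i. *)
  have <- : X i i *m X i i = X i i by rewrite XM eqxx.
  rewrite mul0mx mulmxA; apply/sub_kermxP.
  apply: submx_trans sub_ker _; apply/sumsmx_subP => j /= ji.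
  by apply/sub_kermxP; rewrite XM (negPf ji).
have full : \rank (\sum_i X i i)%MS = m.
  apply/eqP; rewrite -[_ == m]/(row_full _) -sub1mx -X1.
  by apply: summx_sub_sums => i _; apply: submx_refl.
have rank_le i j : (\rank (X i i) <= \rank (X j j))%N.
  have -> : X i i = X i j *m X j j *m X j i by rewrite (XM i j j j) eqxx XM eqxx.
  by apply: leq_trans (mxrankM_maxl _ _) (mxrankM_maxr _ _).
move/mxdirectP: direct; rewrite full /= => ->.
case: n X {XM X1 full} rank_le => [|n] X rank_le; first by rewrite big_ord0.
rewrite (eq_bigr (fun=> \rank (X ord0 ord0))) => [|i _].
  by rewrite sum_nat_const card_ord dvdn_mulr.
by apply/eqP; rewrite eqn_leq !rank_le.
Qed.

(** The n^2 units lie in a common level l of the tower; read there as matrices of size N l over F,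
    they satisfy the hypotheses of [mx_mxunits_dvdn]. *)
Lemma mxunits_tower_dvdn (F : fieldType) (A : algType F) n
    (e : nat -> nat -> A) (N : nat -> nat) (E : nat -> nat -> nat -> A) :
  mxunits n e -> tower N E -> tower_alg N E = [set: A] ->
  exists l, (n %| N l)%N.
Proof.
move=> [eM e1] TE ET.
have /choice[L eL] (p : 'I_n * 'I_n) : exists l, mxspan (N l) (E l) (e p.1 p.2).
  have: tower_alg N E (e p.1 p.2) by rewrite ET.
  by move=> [l _ el]; exists l.
pose l := (\max_p L p)%N; exists l.
have /choice[X eX] (p : 'I_n * 'I_n) :
    exists X : 'M[F]_(N l), mx_eval (E l) X = e p.1 p.2.
  have [X _ <-] := tower_mxspan_le TE (leq_bigmax p : L p <= l)%N (eL p).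
  by exists X.
have EU := TE.1 l.
apply: (@mx_mxunits_dvdn F n _ (fun i j => X (i, j))) => [i j k h|].
  apply: (mx_eval_inj EU); rewrite -mx_evalM // !eX /= eM.
  by case: (j == k); rewrite ?eX // !mulr0n linear0.
apply: (mx_eval_inj EU); rewrite mx_eval1 // -e1.
by rewrite linear_sum; apply: eq_bigr => i _; rewrite /= eX.
Qed.

(** * Linearity of the lift from a free module *)

HB.instance Definition _ (R : nzRingType) (K : choiceType) (M : lmodType R)
    (f : K -> M) :=
  GRing.isZmodMorphism.Build {freeg K / R} M (fglift f) (lift_is_additive f).

Lemma fglift_scalable (R : nzRingType) (K : choiceType) (M : lmodType R)
  (f : K -> M) : scalable (fglift f).
Proof.
move=> c D; rewrite -[in RHS](freeg_sumE D) [c *: D]/(fgscale c D) /fgscale.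
rewrite !raddf_sum; apply: eq_bigr => x _.
by rewrite /= !liftU scalerA.
Qed.

HB.instance Definition _ (R : nzRingType) (K : choiceType) (M : lmodType R)
    (f : K -> M) :=
  GRing.isScalable.Build R {freeg K / R} M *:%R (fglift f) (fglift_scalable f).

(** * The tower of a sequence of commuting matrix algebras *)

Section TensorTower.
Context (F : fieldType) (A : algType F).
Context (n_ : nat -> nat) (u : nat -> nat -> nat -> A).

Fixpoint tensor_size k : nat :=
  if k is h.+1 then (tensor_size h * n_ h)%N else 1%N.

(** Kronecker products of the units of the first k factors. Each new factor takes the most
    significant digit, so that dropping it is an instance of [refine]. *)
Fixpoint tensor_units k (i j : nat) : A :=
  if k is h.+1 then
    tensor_units h (i %% tensor_size h) (j %% tensor_size h) *
      u h (i %/ tensor_size h) (j %/ tensor_size h)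
  else 1.

Context (uU : forall k, mxunits (n_ k) (u k)).
Context (u_comm : forall k h x y, k != h ->
  mxspan (n_ k) (u k) x -> mxspan (n_ h) (u h) y -> x * y = y * x).

Local Notation N := tensor_size.
Local Notation E := tensor_units.

Lemma tensor_size_gt0 k : (0 < N k)%N.
Proof. by elim: k => //= k IHk; rewrite muln_gt0 IHk (mxunits_gt0 (uU k)). Qed.

(** The recursion read on digits; once [ltn_tensor_size] has split an index, no computation with
    [%%] or [%/] remains below. *)
Lemma tensor_unitsS k i j a b : (i < N k)%N -> (j < N k)%N ->
  E k.+1 (i + N k * a) (j + N k * b) = E k i j * u k a b.
Proof.
move=> iN jN; rewrite /= ![(_ + N k * _)%N]addnC ![(N k * _)%N]mulnC.
by rewrite !modnMDl !divnMDl ?tensor_size_gt0 // !modn_small ?divn_small ?addn0.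
Qed.

Lemma ltn_tensor_size k i : (i < N k.+1)%N ->
  [/\ (i %% N k < N k)%N, (i %/ N k < n_ k)%N & i = (i %% N k + N k * (i %/ N k))%N].
Proof.
move=> iN; split; first by rewrite ltn_mod tensor_size_gt0.
  by rewrite ltn_divLR ?tensor_size_gt0 // mulnC.
by rewrite addnC mulnC -divn_eq.
Qed.

(** Level k only involves factors of index below k <= h, and each of them commutes with factor h. *)
Lemma tensor_units_comm k h i j x : (k <= h)%N -> (i < N k)%N -> (j < N k)%N ->
  mxspan (n_ h) (u h) x -> E k i j * x = x * E k i j.
Proof.
elim: k i j => [|k IHk] i j kh iN jN ux; first by rewrite mul1r mulr1.
have [iN' in' ->] := ltn_tensor_size iN; have [jN' jn' ->] := ltn_tensor_size jN.
rewrite tensor_unitsS // -mulrA (@u_comm k h _ x) ?ltn_eqF //; last first.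
  exact: mem_mxspan.
by rewrite mulrA IHk ?mulrA // ltnW.
Qed.

Lemma tensor_units_mxunits k : mxunits (N k) (E k).
Proof.
elim: k => [|k [EM E1]].
  split=> [i j l h|]; last by rewrite big_ord1.
  by rewrite !ord1 mul1r.
have [uM u1] := uU k; split=> [i j l h|]; last first.
  rewrite (sum_mulnE (N k) (n_ k) (fun i => E k.+1 i i)) -u1.
  apply: eq_bigr => t _; rewrite -[RHS]mul1r -E1 mulr_suml.
  by apply: eq_bigr => i _; rewrite tensor_unitsS.
rewrite -val_eqE; case: i j l h => [i iN] [j jN] [l lN] [h hN] /=.
rewrite -/(E k.+1 i j) -/(E k.+1 l h) -/(E k.+1 i h).
have [iN' in' ->] := ltn_tensor_size iN; have [jN' jn' ->] := ltn_tensor_size jN.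
have [lN' ln' ->] := ltn_tensor_size lN; have [hN' hn' ->] := ltn_tensor_size hN.
rewrite !tensor_unitsS // eqn_digits // -mulrA [X in _ * X]mulrA.
(* Swapping the two middle factors separates the product into one of level k units and one of units
   of factor k. *)
rewrite -(tensor_units_comm (leqnn k)) //; last exact: mem_mxspan.
rewrite -mulrA mulrA (EM (Ordinal iN') (Ordinal jN') (Ordinal lN') (Ordinal hN')).
rewrite (uM (Ordinal in') (Ordinal jn') (Ordinal ln') (Ordinal hn')) -!val_eqE /=.
by do 2!case: eqP => _ //=; rewrite ?mulr0n ?mulr1n ?mul0r ?mulr0.
Qed.

(** Inserting 1 = sum_t u k t t on the right of a level k unit produces the block sum of
    [refine]. *)
Lemma tensor_tower : tower N E.
Proof.
split=> k; first exact: tensor_units_mxunits.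
exists (n_ k) => // i j iN jN.
rewrite -[LHS]mulr1 -(uU k).2 mulr_sumr; apply: eq_bigr => t _.
by rewrite tensor_unitsS.
Qed.

Lemma mxspan_tensorS k x y : mxspan (N k) (E k) x -> mxspan (n_ k) (u k) y ->
  mxspan (N k.+1) (E k.+1) (x * y).
Proof.
move=> [X _ <-] [Y _ <-]; have scl := @mxspan_submod _ _ (N k.+1) (E k.+1).
rewrite /mx_eval mulr_suml; apply: (submod_sum scl) => i.
rewrite mulr_suml; under eq_bigr do rewrite -scalerAl.
apply: (submod_sumZ _ scl) => j; rewrite mulr_sumr; apply: (submod_sum scl) => a.
rewrite mulr_sumr; under eq_bigr do rewrite -scalerAr.
apply: (submod_sumZ _ scl) => b; rewrite -tensor_unitsS //.
by apply: mem_mxspan; apply: ltn_digits.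
Qed.

Lemma diagspan_tensorS k : diagspan (n_ k) (u k) `<=` diagspan (N k.+1) (E k.+1).
Proof.
apply: diagspan_sub => [|i ik]; first exact: diagspan_submod.
rewrite -[u k i i]mul1r -(tensor_units_mxunits k).2 mulr_suml.
apply: submod_sum => [|a]; first exact: diagspan_submod.
by rewrite -tensor_unitsS //; apply: mem_diagspan; apply: ltn_digits.
Qed.

(** A diagonal unit of level k is a product of diagonal units, one for each digit of its index.
    Conversely, a diagonal unit of factor k is a sum of diagonal units of level k.+1. *)
Lemma tensor_tower_diag :
  tower_diag N E = alg_span (\bigcup_k diagspan (n_ k) (u k)).
Proof.
apply/seteqP; split=> [x [k _ Ex] S /= [Scl uS]|].
  move: x Ex; apply: diagspan_sub; first exact: subalg_submod.
  have /subalg_closedP[S1 _ SM] := Scl.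
  elim: k => [|k IHk] i iN //; have [iN' in' ->] := ltn_tensor_size iN.
  rewrite tensor_unitsS //; apply: SM; first exact: IHk.
  by apply: uS; exists k => //; apply: mem_diagspan.
apply: smallest_sub; first exact: tower_diag_subalg tensor_tower.
by move=> x [k _ ux]; exists k.+1 => //; apply: diagspan_tensorS.
Qed.

Lemma tensor_mul_image_sub k :
  tensor_mul_image (fun i : 'I_k => mxspan (n_ i) (u i)) `<=` mxspan (N k) (E k).
Proof.
move=> _ [t tfree <-].
have /submod_closedP[S0 SD] := @mxspan_submod _ _ (N k) (E k).
(* [tensor_free] is a smallest subspace, so it lies in the preimage of the span under [tensor_mul]
   as soon as the pure tensors do. *)
apply: (tfree [set t | mxspan (N k) (E k) (tensor_mul t)]); split=> /=.
  apply/submod_closedP; split; first by rewrite /= /tensor_mul linear0.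
  by move=> c v w Sv Sw; rewrite /= /tensor_mul linearP; apply: SD.
move=> _ [a ua <-]; rewrite /= /tensor_mul liftU scale1r.
elim: k a ua {t tfree S0 SD} => [|k IHk] a ua.
  rewrite big_ord0; have /subalg_closedP[] := mxspan_subalg (tensor_units_mxunits 0).
  by [].
rewrite big_ord_recr /=; apply: mxspan_tensorS; last exact: (ua ord_max).
(* The first k factors are repackaged as a function on ['I_k] for the induction hypothesis. *)
rewrite (eq_bigr [ffun i : 'I_k => a (widen_ord (leqnSn k) i)]) => [|i _].
  by apply: IHk => i; rewrite ffunE; apply: (ua (widen_ord (leqnSn k) i)).
by rewrite ffunE.
Qed.

End TensorTower.

(** * Cartan subalgebras of matrix algebras are diagonalizable *)

(** A nonzero row r i of e i is fixed by e i and killed by every other e j. These m.+1 rows are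
    therefore independent, and they form the base change P. *)
Lemma cartan_mxP (F : fieldType) m (K : set 'M[F]_m.+1) : cartan_mx K ->
  exists2 P : 'M[F]_m.+1, P \in unitmx &
    K = [set invmx P *m diag_mx d *m P | d in [set: 'rV[F]_m.+1]].
Proof.
case=> e [e0 eM ->].
have /choice[r rP] i : exists r : 'rV[F]_m.+1, r != 0 /\ r *m e i = r.
  exists (nz_row (e i)); rewrite nz_row_eq0; split=> //.
  have /submxP[w ->] := nz_row_sub (e i).
  by rewrite -mulmxA -[e i *m _]/(e i * _) eM eqxx.
pose P : 'M[F]_m.+1 := \matrix_i r i.
have rM i j : r i *m e j = r i *+ (i == j).
  rewrite -{1}(rP i).2 -mulmxA -[e i *m _]/(e i * _) eM.
  by case: eqP => _; rewrite ?mulmx0 // (rP i).2.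
have PU : P \in unitmx.
  rewrite -row_free_unit -kermx_eq0; apply/rowV0P => v /sub_kermxP vP.
  apply/rowP => j; rewrite mxE; apply/eqP; apply: contraT => vj.
  (* Multiplying a relation between the rows by e j isolates its j-th term. *)
  have : v *m P *m e j = v 0 j *: r j.
    rewrite (mulmx_sum_row v P) mulmx_suml (bigD1 j) //= big1 => [|i ij].
      by rewrite addr0 rowK -scalemxAl rM eqxx.
    by rewrite rowK -scalemxAl rM (negPf ij) scaler0.
  move/esym/eqP; rewrite vP mul0mx scaler_eq0 (negPf vj) /=.
  by rewrite (negPf (rP j).1).
have Pe j : P *m e j = delta_mx j j *m P.
  apply/row_matrixP => i; rewrite !row_mul rowK rM rowE mul_delta_mx_cond.
  case: eqP => [->|_]; first by rewrite -rowE rowK.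
  by rewrite mul0mx.
have eE (c : 'I_m.+1 -> F) :
    \sum_i c i *: e i = invmx P *m diag_mx (\row_i c i) *m P.
  rewrite -mulmxA -[LHS](mulKmx PU) mulmx_sumr; congr (_ *m _).
  rewrite diag_mx_sum_delta mulmx_suml; apply: eq_bigr => i _.
  by rewrite mxE -scalemxAr -scalemxAl Pe.
exists P => //; apply/seteqP; split=> [_ [c ->]|_ [d _ <-]].
  by exists (\row_i c i).
exists (d 0); rewrite eE; congr (_ *m diag_mx _ *m _).
by apply/rowP => i; rewrite mxE.
Qed.

(** The standard matrix units are conjugated by the base change of [cartan_mxP], then sent into A by
    f. *)
Lemma cartan_mxunits (F : fieldType) (A : algType F) m (S H : set A) :
  cartan_of_matrix_subalg m S H ->
  exists v, [/\ mxunits m.+1 v, mxspan m.+1 v = S & diagspan m.+1 v = H].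
Proof.
case=> f [_ fS [K /cartan_mxP[P PU ->] ->]].
pose g (X : 'M[F]_m.+1) := f (invmx P *m X *m P).
have gM X Y : g X * g Y = g (X *m Y).
  by rewrite /g -rmorphM /= -!mulmxE !mulmxA (mulmxK PU).
(* [inord] sends indices above m to 0; only indices up to m matter. *)
pose v i j := g (delta_mx (inord i) (inord j)).
have vE (X : 'M[F]_m.+1) : mx_eval v X = g X.
  rewrite [in RHS](matrix_sum_delta X) /g mulmx_sumr mulmx_suml linear_sum.
  apply: eq_bigr => i _; rewrite /= mulmx_sumr mulmx_suml linear_sum.
  apply: eq_bigr => j _.
  by rewrite /= -scalemxAr -scalemxAl linearZ /v /g !inord_val.
exists v; split.
- split=> [i j k l|].
    rewrite /v gM !inord_val mul_delta_mx_cond.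
    by case: (j == k); rewrite ?mulr1n // !mulr0n /g mulmx0 mul0mx linear0.
  have := vE 1%:M; rewrite -diag_const_mx mx_eval_diag diag_const_mx /g.
  rewrite mulmx1 mulVmx // rmorph1 => <-.
  by apply: eq_bigr => i _; rewrite mxE scale1r.
- rewrite -fS; apply/seteqP; split=> [_ [X _ <-]|_ [X _ <-]].
    by exists (invmx P *m X *m P).
  exists (P *m X *m invmx P) => //.
  by rewrite vE /g !mulmxA mulVmx // mul1mx mulmxKV.
- apply/seteqP; split=> [_ [d _ <-]|_ [_ [d _ <-] <-]].
    by exists (invmx P *m diag_mx d *m P); [exists d | rewrite vE].
  by exists d => //; rewrite vE.
Qed.

(** * From Cartan subalgebras to towers, and conjugacy *)

(** Units adapted to H_i are chosen in each A_i and multiplied together; the tower exhausts A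
    because the images of the multiplication maps do. *)
Lemma cartan_tower (F : fieldType) (A : algType F) (H : set A) :
  cartan_subalg H -> exists (N : nat -> nat) (E : nat -> nat -> nat -> A),
    [/\ tower N E, tower_alg N E = [set: A] & tower_diag N E = H].
Proof.
case=> m_ [A_ [H_ [[_ A_comm _ A_cover] HA ->]]].
have /choice[u uP] k := cartan_mxunits (HA k).
have uU k : mxunits (m_ k).+1 (u k) by case: (uP k).
have uA k : mxspan (m_ k).+1 (u k) = A_ k by case: (uP k).
have uH k : diagspan (m_ k).+1 (u k) = H_ k by case: (uP k).
pose n_ k := (m_ k).+1.
have u_comm k h x y : k != h ->
    mxspan (n_ k) (u k) x -> mxspan (n_ h) (u h) y -> x * y = y * x.
  by rewrite /n_ !uA; apply: A_comm.
exists (tensor_size n_), (tensor_units n_ u); split.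
- exact: tensor_tower.
- apply/seteqP; split=> // a _; move: (I : [set: A] a); rewrite -A_cover.
  move=> [k _ Ba]; exists k => //; apply: (tensor_mul_image_sub uU u_comm).
  by rewrite /n_; under eq_fun do rewrite uA.
- rewrite (tensor_tower_diag uU u_comm); congr alg_span.
  by apply: eq_bigcupr => k _; rewrite /n_ uH.
Qed.

Theorem theorem2 (F : closedFieldType) (A : algType F)
    (lmA : locally_matrix A) (cdA : countably_infinite_dim A)
    (H' H'' : set A) (cH' : cartan_subalg H') (cH'' : cartan_subalg H'') :
  exists phi : {lrmorphism A -> A}, bijective phi /\ phi @` H' = H''.
Proof.
have [N [D [TD D_all <-]]] := cartan_tower cH'.
have [M [E [TE E_all <-]]] := cartan_tower cH''.
(* The second tower takes the sizes of the first and keeps its diagonal. Each divisibility comes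
   from viewing the units of one tower inside the other. *)
have [|k|l|G TG [G_all <-]] := retower (M := N) TE.
- by move=> k; have [r -> _] := TD.2 k; apply: dvdn_mulr.
- exact: mxunits_tower_dvdn (TD.1 k) TE E_all.
- exact: mxunits_tower_dvdn (TE.1 l) TD D_all.
by apply: tower_conjugate TD TG D_all _; rewrite G_all.
Qed.
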